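(* Let $\epsilon\in\{+1,-1\}$. For integers $k,l\ge0$ let $T^{\epsilon}_{kl}$ be the polynomial defined by $$T^{-}_{kl}(x)=\int_{-1}^{x}T_k(x-\tau-1)T_l(\tau)\,d\tau,\qquad T^{+}_{kl}(x)=-\int_{x}^{1}T_k(x-\tau+1)T_l(\tau)\,d\tau$$ (the superscript being the sign of $\epsilon$), and let $t^{j(\epsilon)}_{k,l}$, $j\ge0$, be its Chebyshev coefficients in the normalization $$T^{\epsilon}_{kl}(x)=\tfrac12 t^{0(\epsilon)}_{k,l}+\sum_{j=1}^{k+l+1}t^{j(\epsilon)}_{k,l}T_j(x),\qquad t^{j(\epsilon)}_{k,l}=0\ \text{for } j>k+l+1 .$$ Then, for all $j\ge0$: (a) $t^{0(\epsilon)}_{1,0}=-\frac12$, $t^{2(\epsilon)}_{1,0}=\frac14$, and $t^{j(\epsilon)}_{1,0}=0$ for all other $j$. (b) For $k\neq1$: $t^{0(\epsilon)}_{k,0}=\frac{2\epsilon^{k+1}}{k^2-1}$; if $k=0$, $t^{1(\epsilon)}_{0,0}=1$; if $k>1$, $t^{k-1(\epsilon)}_{k,0}=-\frac{1}{2k-2}$ and $t^{k+1(\epsilon)}_{k,0}=\frac{1}{2k+2}$; and $t^{j(\epsilon)}_{k,0}=0$ for all other $j$. (c) For $l>0$ and $0\le j\le l+2$: $$t^{j(\epsilon)}_{1,l}=\frac12\Big[\frac{t^{j-1(\epsilon)}_{0,l}}{2^{\delta_{j,1}}}\delta_{j>0}+\frac12 t^{0(\epsilon)}_{0,l}\delta_{j,1}+2^{\delta_{j,0}}t^{j+1(\epsilon)}_{0,l}\delta_{j\le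 l}-t^{j(\epsilon)}_{0,l+1}-t^{j(\epsilon)}_{0,l-1}\delta_{j\le l}+2\epsilon\,t^{j(\epsilon)}_{0,l}\delta_{j\le l+1}\Big].$$ (d) For $k>0$, $l>0$ and $0\le j\le k+l+2$: $$t^{j(\epsilon)}_{k+1,l}=\frac{t^{j-1(\epsilon)}_{k,l}}{2^{\delta_{j,1}}}\delta_{j>0}+\frac12 t^{0(\epsilon)}_{k,l}\delta_{j,1}+2^{\delta_{j,0}}t^{j+1(\epsilon)}_{k,l}\delta_{j\le k+l}-t^{j(\epsilon)}_{k,l+1}-t^{j(\epsilon)}_{k,l-1}\delta_{j\le k+l}+2\epsilon\,t^{j(\epsilon)}_{k,l}\delta_{j\le k+l+1}-t^{j(\epsilon)}_{k-1,l}\delta_{j\le k+l}.$$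
   Context: $T_j$ denotes the $j$-th Chebyshev polynomial of the first kind. $\delta_{a,b}$ is the Kronecker delta and $\delta_{P}$ equals $1$ if the condition $P$ holds and $0$ otherwise (terms multiplied by a vanishing $\delta_P$ are omitted, in particular $t^{-1(\epsilon)}$ never contributes). *)

(* Defs.v *)
From Stdlib Require Import Reals Lra Lia Arith ClassicalEpsilon.
From Coquelicot Require Import Coquelicot.
Open Scope R_scope.

(** Chebyshev polynomials of the first kind, as polynomial functions on R. *)
Fixpoint cheb (n : nat) (x : R) : R :=
  match n with
  | O => 1
  | S m => match m with
           | O => x
           | S p => 2 * x * cheb m x - cheb p x
           end
  end.

Inductive sign : Set := Sneg | Spos.

Definition sgn (e : sign) : R :=
  match e with Sneg => -1 | Spos => 1 end.

(** [RInt] is the oriented integral, so that these are polynomial functions of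
    [x] on the whole line, and not only for [-1 <= x <= 1]. *)
Definition Tconv (e : sign) (k l : nat) (x : R) : R :=
  match e with
  | Sneg => RInt (fun tau => cheb k (x - tau - 1) * cheb l tau) (-1) x
  | Spos => - RInt (fun tau => cheb k (x - tau + 1) * cheb l tau) x 1
  end.

(** [c j] is the [j]-th Chebyshev coefficient of [f], of degree at most [n],
    the constant term being halved. *)
Definition is_cheb_coef (f : R -> R) (n : nat) (c : nat -> R) : Prop :=
  (forall x, f x = 1 / 2 * c O + sum_n_m (fun j => c j * cheb j x) 1 n) /\
  (forall j, (n < j)%nat -> c j = 0).

(** [t k l j] is the coefficient with superscript [j] and subscripts [k, l]. *)
Definition is_conv_coef (e : sign) (t : nat -> nat -> nat -> R) : Prop :=
  forall k l, is_cheb_coef (Tconv e k l) (k + l + 1) (t k l).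

(** The Kronecker symbol of a decided condition; it also occurs as an exponent,
    hence the type [nat]. *)
Definition delta (b : bool) : nat := if b then 1%nat else 0%nat.

(** The rest of the file shows that coefficients as in [is_conv_coef] exist. *)

(* [ring] needs the type [R] in place of a structure carrier. *)
Ltac Rring := lazymatch goal with |- ?u = ?v => change (@eq R u v) end; ring.

Definition cheb_span (n : nat) (f : R -> R) : Prop :=
  exists c, is_cheb_coef f n c.

Lemma cheb_SS n x : cheb (S (S n)) x = 2 * x * cheb (S n) x - cheb n x.
Proof. reflexivity. Qed.

Lemma cheb_span_ext n f g :
  (forall x, f x = g x) -> cheb_span n f -> cheb_span n g.
Proof.
intros E [c [H H0]]; exists c; split; [|exact H0].
intros x; rewrite <- E; apply H.
Qed.

Lemma cheb_span_S n f : cheb_span n f -> cheb_span (S n) f.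
Proof.
intros [c [H H0]]; exists c; split; [|intros j Hj; apply H0; lia].
intros x; rewrite H, sum_n_Sm by lia; rewrite (H0 (S n)) by lia.
change (@Hierarchy.plus _) with Rplus.
rewrite Rmult_0_l; ring.
Qed.

Lemma cheb_span_le n m f : (n <= m)%nat -> cheb_span n f -> cheb_span m f.
Proof.
induction 1; intros Hf; auto; apply cheb_span_S; auto.
Qed.

Lemma cheb_span_lin n a b f g :
  cheb_span n f -> cheb_span n g ->
  cheb_span n (fun x => a * f x + b * g x).
Proof.
intros [c [H H0]] [d [K K0]]; exists (fun j => a * c j + b * d j); split.
- intros x; rewrite H, K.
  assert (E : sum_n_m (fun j => (a * c j + b * d j) * cheb j x) 1 n =
    a * sum_n_m (fun j => c j * cheb j x) 1 n + b * sum_n_m (fun j => d j * cheb j x) 1 n).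
  + symmetry; etransitivity.
    * apply (f_equal2 Rplus); symmetry; apply (sum_n_m_mult_l (K := R_Ring)).
    * etransitivity; [symmetry; apply (sum_n_m_plus (G := R_AbelianMonoid))|].
      apply sum_n_m_ext; intros j; change (@Hierarchy.plus _) with Rplus.
      change (@mult _) with Rmult; Rring.
  + rewrite E; ring.
- intros j Hj; rewrite H0, K0 by assumption; ring.
Qed.

Lemma cheb_span_zero n : cheb_span n (fun _ => 0).
Proof.
exists (fun _ => 0); split; [|reflexivity].
intros x; rewrite (sum_n_m_ext _ (fun _ => zero)).
- rewrite sum_n_m_const_zero; change (@zero _) with 0; Rring.
- intros j; change (@zero _) with 0; Rring.
Qed.

Lemma cheb_span_cheb n : cheb_span n (cheb n).
Proof.
destruct n as [|n].
- exists (fun j => if Nat.eqb j 0 then 2 else 0); split.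
  + intros x; rewrite sum_n_m_zero by lia; change (@zero _) with 0; simpl; field.
  + intros [|j] Hj; [lia|reflexivity].
- exists (fun j => if Nat.eqb j (S n) then 1 else 0); split.
  + intros x; rewrite sum_n_Sm by lia.
    rewrite (sum_n_m_ext_loc _ (fun _ => zero)).
    * rewrite sum_n_m_const_zero, Nat.eqb_refl; change (@zero _) with 0.
      change (@Hierarchy.plus _) with Rplus; cbn [Nat.eqb]; Rring.
    * intros j Hj; destruct (Nat.eqb_spec j (S n)); [lia|].
      change (@zero _) with 0; Rring.
  + intros j Hj; destruct (Nat.eqb_spec j (S n)); [lia|reflexivity].
Qed.

Lemma x_cheb n x : x * cheb (S n) x = 1 / 2 * cheb (S (S n)) x + 1 / 2 * cheb n x.
Proof. rewrite cheb_SS; field. Qed.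

Lemma cheb_span_x_cheb n : cheb_span (S n) (fun x => x * cheb n x).
Proof.
destruct n as [|n].
- apply (cheb_span_ext _ (cheb 1)); [intros x; simpl; ring|apply cheb_span_cheb].
- apply (cheb_span_ext _ (fun x => 1 / 2 * cheb (S (S n)) x + 1 / 2 * cheb n x)).
  + intros x; rewrite x_cheb; reflexivity.
  + apply cheb_span_lin; [apply cheb_span_cheb|].
    apply (cheb_span_le n); [lia|apply cheb_span_cheb].
Qed.

Lemma cheb_span_mulx n f : cheb_span n f -> cheb_span (S n) (fun x => x * f x).
Proof.
intros [c [H _]].
enough (A : forall m, (m <= n)%nat ->
  cheb_span (S n) (fun x => x * (1 / 2 * c O + sum_n_m (fun j => c j * cheb j x) 1 m))).
{ apply (cheb_span_ext _ _ _ (fun x => f_equal (Rmult x) (eq_sym (H x)))).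
  apply A; lia. }
induction m as [|m IH]; intros Hm.
- apply (cheb_span_ext _ (fun x => (1 / 2 * c O) * (x * cheb 0 x) + 0 * 0)).
  + intros x; rewrite sum_n_m_zero by lia; change (@zero _) with 0; simpl; Rring.
  + apply (cheb_span_le 1); [lia|].
    apply cheb_span_lin; [apply cheb_span_x_cheb|apply cheb_span_zero].
- apply (cheb_span_ext _ (fun x =>
    1 * (x * (1 / 2 * c O + sum_n_m (fun j => c j * cheb j x) 1 m))
    + c (S m) * (x * cheb (S m) x))).
  + intros x; rewrite sum_n_Sm by lia; change (@Hierarchy.plus _) with Rplus; ring.
  + apply cheb_span_lin; [apply IH; lia|].
    apply (cheb_span_le (S (S m))); [lia|apply cheb_span_x_cheb].
Qed.

Fixpoint cheb2 (n : nat) (x : R) : R :=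
  match n with
  | O => 1
  | S m => match m with
           | O => 2 * x
           | S p => 2 * x * cheb2 m x - cheb2 p x
           end
  end.

Lemma cheb2_SS n x : cheb2 (S (S n)) x = 2 * x * cheb2 (S n) x - cheb2 n x.
Proof. reflexivity. Qed.

Lemma cheb2_cheb n x : cheb2 (S (S n)) x - cheb2 n x = 2 * cheb (S (S n)) x.
Proof.
enough (A : cheb2 (S (S n)) x - cheb2 n x = 2 * cheb (S (S n)) x /\
            cheb2 (S (S (S n))) x - cheb2 (S n) x = 2 * cheb (S (S (S n))) x)
  by apply A.
induction n as [|n [IH1 IH2]]; [simpl; split; ring|split; [exact IH2|]].
rewrite (cheb2_SS (S (S n))), (cheb_SS (S (S n))).
replace (cheb2 (S (S n)) x) with (2 * x * cheb2 (S n) x - cheb2 n x) at 2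
  by (rewrite cheb2_SS; reflexivity).
nra.
Qed.

Lemma is_derive_cheb n x :
  is_derive (cheb (S n)) x (INR (S n) * cheb2 n x).
Proof.
enough (A : is_derive (cheb (S n)) x (INR (S n) * cheb2 n x) /\
            is_derive (cheb (S (S n))) x (INR (S (S n)) * cheb2 (S n) x))
  by apply A.
induction n as [|n [IH1 IH2]].
- split.
  + apply (is_derive_ext (fun y => y)); [reflexivity|].
    auto_derive; [auto|simpl; ring].
  + apply (is_derive_ext (fun y => 2 * y * y - 1)); [reflexivity|].
    auto_derive; [auto|simpl; ring].
- split; [exact IH2|].
  apply (is_derive_ext (fun y => (2 * y) * cheb (S (S n)) y - cheb (S n) y));
    [reflexivity|].
  replace (INR (S (S (S n))) * cheb2 (S (S n)) x) with
    (Hierarchy.minus (Hierarchy.plus (mult 2 (cheb (S (S n)) x))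
                           (mult (2 * x) (INR (S (S n)) * cheb2 (S n) x)))
           (INR (S n) * cheb2 n x)).
  + apply @is_derive_minus; [|exact IH1].
    apply @is_derive_mult; [|exact IH2|intros; apply Rmult_comm].
    auto_derive; [auto|ring].
  + unfold Hierarchy.minus; change (@Hierarchy.plus _) with Rplus.
    change (@mult _) with Rmult; change (@opp _) with Ropp.
    rewrite !S_INR; pose proof (cheb2_cheb n x) as E.
    rewrite cheb2_SS in *; nra.
Qed.

Lemma continuous_cheb n x : continuous (cheb n) x.
Proof.
destruct n as [|n]; [apply continuous_const|].
apply @ex_derive_continuous; eexists; apply is_derive_cheb.
Qed.

Definition conv (a : R) (f g : R -> R) (x : R) : R :=
  RInt (fun tau => f (x - tau + a) * g tau) a x.

Definition cont (f : R -> R) : Prop := forall x, continuous f x.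

Lemma cont_lin a b f g : cont f -> cont g -> cont (fun x => a * f x + b * g x).
Proof.
intros Hf Hg x.
apply (continuous_plus (fun x => a * f x) (fun x => b * g x)).
- apply (continuous_mult (fun _ => a) f); [apply continuous_const|apply Hf].
- apply (continuous_mult (fun _ => b) g); [apply continuous_const|apply Hg].
Qed.

Lemma cont_conv_integrand a f g x :
  cont f -> cont g -> cont (fun tau => f (x - tau + a) * g tau).
Proof.
intros Hf Hg tau.
apply (continuous_mult (fun tau => f (x - tau + a)) g); [|apply Hg].
apply (continuous_comp (fun tau => x - tau + a) f); [|apply Hf].
apply @ex_derive_continuous; auto_derive; auto.
Qed.

Lemma ex_RInt_cont f a b : cont f -> ex_RInt f a b.
Proof. intros Hf; apply @ex_RInt_continuous; intros; apply Hf. Qed.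

Lemma RInt_lin a b c d f g : cont f -> cont g ->
  RInt (fun x => a * f x + b * g x) c d = a * RInt f c d + b * RInt g c d.
Proof.
intros Hf Hg.
apply (@is_RInt_unique R_CompleteNormedModule).
apply (@is_RInt_plus R_NormedModule (fun x => a * f x) (fun x => b * g x)).
- apply (@is_RInt_scal R_NormedModule f); apply (@RInt_correct R_CompleteNormedModule); apply ex_RInt_cont; assumption.
- apply (@is_RInt_scal R_NormedModule g); apply (@RInt_correct R_CompleteNormedModule); apply ex_RInt_cont; assumption.
Qed.

Lemma Tconv_conv e k l x : Tconv e k l x = conv (sgn e) (cheb k) (cheb l) x.
Proof.
destruct e; unfold Tconv, conv; [reflexivity|].
rewrite <- opp_RInt_swap; [change (@opp _) with Ropp; simpl; ring|].
apply ex_RInt_cont, cont_conv_integrand; intros y; apply continuous_cheb.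
Qed.

Lemma is_derive_primitive l x :
  is_derive (fun y => / (2 * INR (S (S (S l)))) * cheb (S (S (S l))) y
                      + (- / (2 * INR (S l))) * cheb (S l) y) x
    (cheb (S (S l)) x).
Proof.
replace (cheb (S (S l)) x) with
  (Hierarchy.plus (/ (2 * INR (S (S (S l)))) * (INR (S (S (S l))) * cheb2 (S (S l)) x))
    (- / (2 * INR (S l)) * (INR (S l) * cheb2 l x))).
- apply @is_derive_plus; apply is_derive_scal, is_derive_cheb.
- change (@Hierarchy.plus _) with Rplus.
  pose proof (cheb2_cheb l x); lazymatch goal with |- ?u = ?v => change (@eq R u v) end.
  transitivity (/ 2 * (cheb2 (S (S l)) x - cheb2 l x)); [|lra].
  field; split; apply not_0_INR; lia.
Qed.

Lemma cheb_span_const n c : cheb_span n (fun _ => c).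
Proof.
apply (cheb_span_ext _ (fun x => c * cheb 0 x + 0 * 0)); [intros x; simpl; ring|].
apply (cheb_span_le 0); [lia|].
apply cheb_span_lin; [apply cheb_span_cheb|apply cheb_span_zero].
Qed.

Lemma cheb_span_primitive a l :
  cheb_span (S l) (fun x => RInt (cheb l) a x).
Proof.
assert (P : exists F, cheb_span (S l) F /\ forall x, is_derive F x (cheb l x)).
{ destruct l as [|[|l]].
  - exists (fun x => x); split; [apply (cheb_span_cheb 1)|].
    intros x; simpl; auto_derive; auto.
  - exists (fun x => 1 / 2 * (x * cheb 1 x) + 0 * 0); split.
    + apply cheb_span_lin; [apply cheb_span_x_cheb|apply cheb_span_zero].
    + intros x; simpl; auto_derive; [auto|field].
  - eexists; split; [|apply is_derive_primitive].
    apply cheb_span_lin; [apply cheb_span_cheb|].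
    apply (cheb_span_le (S l)); [lia|apply cheb_span_cheb]. }
destruct P as [F [HF DF]].
apply (cheb_span_ext _ (fun x => 1 * F x + (-1) * F a)).
- intros x; symmetry; apply (@is_RInt_unique R_CompleteNormedModule).
  replace (1 * F x + -1 * F a) with (Hierarchy.minus (F x) (F a)).
  + apply @is_RInt_derive; intros y _; [apply DF|apply continuous_cheb].
  + unfold Hierarchy.minus; change (@Hierarchy.plus _) with Rplus.
    change (@opp _) with Ropp; Rring.
- apply cheb_span_lin; [exact HF|apply cheb_span_const].
Qed.

Lemma conv_lin_r a f b c g h x : cont f -> cont g -> cont h ->
  conv a f (fun y => b * g y + c * h y) x = b * conv a f g x + c * conv a f h x.
Proof.
intros Hf Hg Hh; unfold conv.
rewrite <- RInt_lin by (apply cont_conv_integrand; assumption).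
apply @RInt_ext; intros; Rring.
Qed.

Lemma conv_lin_l a f b c g h x : cont f -> cont g -> cont h ->
  conv a (fun y => b * g y + c * h y) f x = b * conv a g f x + c * conv a h f x.
Proof.
intros Hf Hg Hh; unfold conv.
rewrite <- RInt_lin by (apply cont_conv_integrand; assumption).
apply @RInt_ext; intros; Rring.
Qed.

Lemma cont_mulx f : cont f -> cont (fun y => y * f y).
Proof.
intros Hf x; apply (continuous_mult (fun y => y) f); [apply continuous_id|apply Hf].
Qed.

Lemma conv_mulx a f g x : cont f -> cont g ->
  conv a (fun y => y * f y) g x =
  (x + a) * conv a f g x + (-1) * conv a f (fun y => y * g y) x.
Proof.
intros Hf Hg; unfold conv; rewrite <- RInt_lin.
- apply @RInt_ext; intros; Rring.
- apply cont_conv_integrand; assumption.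
- apply cont_conv_integrand; [assumption|apply cont_mulx; assumption].
Qed.

Lemma cont_cheb n : cont (cheb n).
Proof. intros x; apply continuous_cheb. Qed.

Lemma conv_ext a f f' g g' x :
  (forall y, f y = f' y) -> (forall y, g y = g' y) -> conv a f g x = conv a f' g' x.
Proof. intros E E'; apply @RInt_ext; intros; rewrite E, E'; reflexivity. Qed.

Lemma cheb_span_conv_mulx a k : (forall l, cheb_span (k + l + 1) (conv a (cheb k) (cheb l))) ->
  forall l, cheb_span (S k + l + 1) (conv a (fun y => y * cheb k y) (cheb l)).
Proof.
intros IH l.
apply (cheb_span_ext _ (fun x =>
  1 * (1 * (x * conv a (cheb k) (cheb l) x) + a * conv a (cheb k) (cheb l) x)
  + (-1) * conv a (cheb k) (fun y => y * cheb l y) x)).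
- intros x; rewrite conv_mulx by apply cont_cheb; ring.
- apply cheb_span_lin; [apply cheb_span_lin|].
  + apply (cheb_span_mulx (k + l + 1)), IH.
  + apply (cheb_span_le (k + l + 1)); [lia|apply IH].
  + destruct l as [|l].
    * apply (cheb_span_ext _ (conv a (cheb k) (cheb 1))).
      { intros x; apply conv_ext; [reflexivity|intros y; simpl; ring]. }
      apply (cheb_span_le (k + 1 + 1)); [lia|apply IH].
    * apply (cheb_span_ext _ (fun x =>
        1 / 2 * conv a (cheb k) (cheb (S (S l))) x + 1 / 2 * conv a (cheb k) (cheb l) x)).
      { intros x; rewrite <- conv_lin_r by apply cont_cheb.
        apply conv_ext; [reflexivity|intros y; rewrite x_cheb; reflexivity]. }
      apply cheb_span_lin.
      -- apply (cheb_span_le (k + S (S l) + 1)); [lia|apply IH].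
      -- apply (cheb_span_le (k + l + 1)); [lia|apply IH].
Qed.

Lemma cheb_span_conv a k l : cheb_span (k + l + 1) (conv a (cheb k) (cheb l)).
Proof.
enough (A : (forall l, cheb_span (k + l + 1) (conv a (cheb k) (cheb l))) /\
            (forall l, cheb_span (S k + l + 1) (conv a (cheb (S k)) (cheb l))))
  by exact (proj1 A l).
clear l; induction k as [|k [IH1 IH2]].
- assert (A : forall l, cheb_span (0 + l + 1) (conv a (cheb 0) (cheb l))).
  { intros l; apply (cheb_span_ext _ (fun x => RInt (cheb l) a x)).
    - intros x; apply @RInt_ext; intros; simpl; Rring.
    - apply (cheb_span_le (S l)); [lia|apply cheb_span_primitive]. }
  split; [exact A|intros l].
  apply (cheb_span_ext _ (conv a (fun y => y * cheb 0 y) (cheb l))).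
  + intros x; apply conv_ext; [intros y; simpl; ring|reflexivity].
  + apply cheb_span_conv_mulx, A.
- split; [exact IH2|intros l].
  apply (cheb_span_ext _ (fun x => 2 * conv a (fun y => y * cheb (S k) y) (cheb l) x
                                   + (-1) * conv a (cheb k) (cheb l) x)).
  + intros x; rewrite <- conv_lin_l by (apply cont_cheb || apply cont_mulx, cont_cheb).
    apply conv_ext; [intros y; rewrite cheb_SS; ring|reflexivity].
  + apply cheb_span_lin; [apply cheb_span_conv_mulx, IH2|].
    apply (cheb_span_le (k + l + 1)); [lia|apply IH1].
Qed.

Lemma is_conv_coef_exists (e : sign) : exists t, is_conv_coef e t.
Proof.
assert (A : forall k l, exists c, is_cheb_coef (Tconv e k l) (k + l + 1) c).
{ intros k l; apply (cheb_span_ext _ (conv (sgn e) (cheb k) (cheb l))).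
  - intros x; symmetry; apply Tconv_conv.
  - apply cheb_span_conv. }
exists (fun k l => proj1_sig (constructive_indefinite_description _ (A k l))).
intros k l; apply proj2_sig.
Qed.

(* Main.v *)
From Stdlib Require Import Lra Lia Arith.
From Coquelicot Require Import Coquelicot.
(* After Coquelicot, whose own [sign] would otherwise hide that of [Defs]. *)
Require Import Defs.
From Stdlib Require Import Reals.
Open Scope R_scope.

(** With a = sgn e, [Tconv e k l] is the convolution of [T_k] and [T_l] based at
    a. The three-term recurrence in k and the identity
    (y f) * g = (x + a) (f * g) - f * (y g) give a recurrence between these
    polynomials, while for l = 0 an explicit antiderivative of [T_k] is available.
    Both identities pass to the coefficients because Chebyshev coefficients are
    unique: on [x >= 1] one has [x T_n <= T_(n+1)], so in a vanishing
    combination the top term dominates the others unless its coefficient is 0. *)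

(** * Uniqueness of Chebyshev coefficients *)

Lemma cheb_growth n x : 1 <= x -> 0 < cheb n x /\ x * cheb n x <= cheb (S n) x.
Proof.
intros Hx; induction n as [|n [IH1 IH2]]; [simpl; lra|].
rewrite cheb_SS.
assert (cheb n x <= x * cheb n x) by nra.
split; [lra|nra].
Qed.

(** On [1 <= x] the values [cheb n x] increase with [n], so the absolute values of the coefficients
    can simply be added up in [M], uniformly in [x]. *)
Lemma cheb_sum_bound (c : nat -> R) n :
  exists M, 0 <= M /\ forall x, 1 <= x ->
    Rabs (1 / 2 * c O + sum_n_m (fun j => c j * cheb j x) 1 n) <= M * cheb n x.
Proof.
induction n as [|n [M [HM H]]].
- exists (Rabs (1 / 2 * c O)); split; [apply Rabs_pos|intros x _].
  rewrite sum_n_m_zero by lia; change (@zero _) with 0; simpl; rewrite Rplus_0_r; lra.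
- exists (M + Rabs (c (S n))); split; [pose proof (Rabs_pos (c (S n))); lra|].
  intros x Hx; rewrite sum_n_Sm by lia; change (@Hierarchy.plus _) with Rplus.
  rewrite <- Rplus_assoc.
  eapply Rle_trans; [apply Rabs_triang|].
  destruct (cheb_growth n x Hx) as [P Q]; destruct (cheb_growth (S n) x Hx) as [P' _].
  rewrite Rabs_mult, (Rabs_pos_eq (cheb (S n) x)) by lra.
  specialize (H x Hx).
  assert (cheb n x <= cheb (S n) x) by nra.
  nra.
Qed.

Lemma cheb_sum_eq0 (c : nat -> R) n :
  (forall x, 1 / 2 * c O + sum_n_m (fun j => c j * cheb j x) 1 n = 0) ->
  forall j, (j <= n)%nat -> c j = 0.
Proof.
induction n as [|n IH]; intros H j Hj.
- specialize (H 0); rewrite sum_n_m_zero in H by lia; change (@zero _) with 0 in H.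
  replace j with O by lia; lra.
- assert (L : c (S n) = 0).
  { destruct (cheb_sum_bound c n) as [M [HM B]].
    destruct (Req_dec (c (S n)) 0) as [|N]; [assumption|exfalso].
    pose proof (Rabs_pos_lt _ N) as A.
    (* Chosen so that [Rabs (c (S n)) * x] exceeds [M], whereas growth and the bound force [Rabs (c
       (S n)) * x * cheb n x <= M * cheb n x] with [cheb n x > 0]. *)
    set (x := 1 + M / Rabs (c (S n))).
    assert (Hq : 0 <= M / Rabs (c (S n)))
      by (apply Rmult_le_pos; [lra|left; apply Rinv_0_lt_compat; lra]).
    assert (Hx : 1 <= x) by (unfold x; lra).
    assert (E : Rabs (c (S n)) * x = Rabs (c (S n)) + M) by (unfold x; field; lra).
    specialize (H x); specialize (B x Hx).
    rewrite sum_n_Sm in H by lia; change (@Hierarchy.plus _) with Rplus in H.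
    rewrite <- Rplus_assoc in H; apply Rplus_opp_r_uniq in H.
    destruct (cheb_growth n x Hx) as [P Q].
    assert (K : Rabs (c (S n)) * cheb (S n) x <= M * cheb n x).
    { rewrite <- (Rabs_pos_eq (cheb (S n) x)) by nra.
      rewrite <- Rabs_mult, H, Rabs_Ropp; exact B. }
    assert (Rabs (c (S n)) * (x * cheb n x) <= Rabs (c (S n)) * cheb (S n) x)
      by (apply Rmult_le_compat_l; lra).
    nra. }
  destruct (Nat.eq_dec j (S n)) as [->|]; [exact L|].
  apply IH; [|lia]; intros x; specialize (H x).
  rewrite sum_n_Sm, L in H by lia; change (@Hierarchy.plus _) with Rplus in H.
  rewrite Rmult_0_l, Rplus_0_r in H; exact H.
Qed.

(** * Operations on coefficient sequences *)

Lemma is_cheb_coef_ext f g n c :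
  (forall x, f x = g x) -> is_cheb_coef f n c -> is_cheb_coef g n c.
Proof. intros E [H H0]; split; [intros x; rewrite <- E; apply H|exact H0]. Qed.

Lemma is_cheb_coef_le f n m c : (n <= m)%nat -> is_cheb_coef f n c -> is_cheb_coef f m c.
Proof.
induction 1 as [|m Hm IH]; [auto|intros Hc; destruct (IH Hc) as [H H0]].
split; [|intros j Hj; apply H0; lia].
intros x; rewrite H, sum_n_Sm, (H0 (S m)) by lia.
change (@Hierarchy.plus _) with Rplus; ring.
Qed.

Lemma is_cheb_coef_lin a b f g n c d :
  is_cheb_coef f n c -> is_cheb_coef g n d ->
  is_cheb_coef (fun x => a * f x + b * g x) n (fun j => a * c j + b * d j).
Proof.
intros [H H0] [K K0]; split; [|intros j Hj; rewrite H0, K0 by assumption; ring].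
intros x; rewrite H, K; clear.
induction n as [|n IH].
- rewrite !sum_n_m_zero by lia; change (@zero _) with 0; Rring.
- rewrite !sum_n_Sm by lia; change (@Hierarchy.plus _) with Rplus in *.
  lra.
Qed.

Lemma is_cheb_coef_unique f n m c d :
  is_cheb_coef f n c -> is_cheb_coef f m d -> forall j, c j = d j.
Proof.
intros Hc Hd j.
apply (is_cheb_coef_le f n (n + m)) in Hc; [|lia].
apply (is_cheb_coef_le f m (n + m)) in Hd; [|lia].
destruct (is_cheb_coef_lin 1 (-1) _ _ _ _ _ Hc Hd) as [H H0].
enough (1 * c j + -1 * d j = 0) by lra.
destruct (le_lt_dec j (n + m)) as [L|L]; [|exact (H0 j L)].
apply (cheb_sum_eq0 (fun j => 1 * c j + -1 * d j) (n + m)); [|exact L].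
intros x; rewrite <- H; ring.
Qed.

(** Comes from 2x T_j = T_(j+1) + T_(j-1) for j >= 1. The factor 2 at index 0 offsets the halving of
    the constant term; at index 1, [c 0] enters whole because 2x (c_0 / 2) = c_0 T_1. *)
Definition coef_mul2x (c : nat -> R) (j : nat) : R :=
  match j with O => 2 * c 1%nat | S i => c i + c (S j) end.

Lemma is_cheb_coef_mul2x f n c :
  is_cheb_coef f n c -> is_cheb_coef (fun x => 2 * x * f x) (S n) (coef_mul2x c).
Proof.
intros [H H0]; split.
- intros x; rewrite H.
  (* For a truncated sum, the right-hand coefficients also count two contributions of terms beyond
     [m]; these are subtracted, and vanish at [m = n]. *)
  assert (E : forall m, 2 * x * (1 / 2 * c O + sum_n_m (fun j => c j * cheb j x) 1 m) =
    1 / 2 * coef_mul2x c 0 + sum_n_m (fun j => coef_mul2x c j * cheb j x) 1 (S m)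
    - c (S m) * cheb m x - c (S (S m)) * cheb (S m) x).
  { induction m as [|m IH].
    - rewrite sum_n_n, sum_n_m_zero by lia; change (@zero _) with 0; simpl; field.
    - rewrite sum_n_Sm, (sum_n_Sm _ 1 (S m)) by lia; change (@Hierarchy.plus _) with Rplus in *.
      cbn [coef_mul2x] in *; rewrite cheb_SS; lra. }
  rewrite E, (H0 (S n)), (H0 (S (S n))) by lia; ring.
- intros [|j] Hj; [lia|]; cbn [coef_mul2x]; rewrite !H0 by lia; ring.
Qed.

Lemma is_cheb_coef_const b n :
  is_cheb_coef (fun _ => b) n (fun j => if Nat.eqb j 0 then 2 * b else 0).
Proof.
apply (is_cheb_coef_le _ 0); [lia|split].
- intros x; rewrite sum_n_m_zero by lia; change (@zero _) with 0; cbn; field.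
- intros [|j] Hj; [lia|reflexivity].
Qed.

Lemma is_cheb_coef_cheb k n : (S k <= n)%nat ->
  is_cheb_coef (cheb (S k)) n (fun j => if Nat.eqb j (S k) then 1 else 0).
Proof.
intros Hn; apply (is_cheb_coef_le _ (S k)); [exact Hn|split].
- intros x; rewrite sum_n_Sm by lia; rewrite (sum_n_m_ext_loc _ (fun _ => zero)).
  + rewrite sum_n_m_const_zero, Nat.eqb_refl; change (@zero _) with 0.
    change (@Hierarchy.plus _) with Rplus; cbn [Nat.eqb]; Rring.
  + intros j Hj; destruct (Nat.eqb_spec j (S k)); [lia|].
    change (@zero _) with 0; Rring.
- intros j Hj; destruct (Nat.eqb_spec j (S k)); [lia|reflexivity].
Qed.

(** * Convolutions based at the endpoint [sgn e] *)

Lemma sgn_sqr e : sgn e * sgn e = 1.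
Proof. destruct e; simpl; ring. Qed.

Lemma cheb_sgn e n : cheb n (sgn e) = sgn e ^ n.
Proof.
enough (A : cheb n (sgn e) = sgn e ^ n /\ cheb (S n) (sgn e) = sgn e ^ S n) by apply A.
induction n as [|n [IH1 IH2]]; [simpl; split; ring|split; [exact IH2|]].
rewrite cheb_SS, IH1, IH2; destruct e; simpl; ring.
Qed.

Lemma conv_cheb0 a f F x : (forall y, is_derive F y (f y)) -> cont f ->
  conv a f (cheb 0) x = F x - F a.
Proof.
intros D C; apply (@is_RInt_unique R_CompleteNormedModule).
(* In [tau] the antiderivative is [- F (x - tau + a)]: the reflection exchanges the endpoints and
   the sign restores the order. *)
replace (F x - F a) with (Hierarchy.minus (- F (x - x + a)) (- F (x - a + a))).
- apply (@is_RInt_derive R_CompleteNormedModule (fun tau => - F (x - tau + a)));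
    intros tau _.
  + evar_last; [apply @is_derive_opp, (is_derive_comp F (fun tau => x - tau + a))|].
    * apply D.
    * auto_derive; [auto|reflexivity].
    * cbn; Rring.
  + apply (cont_conv_integrand a f (cheb 0)); [exact C|apply cont_cheb].
- replace (x - x + a) with a by ring; replace (x - a + a) with x by ring.
  cbn; Rring.
Qed.

(** Doubling [conv_mulx] gives 2 (x + a) (T_k * T_(l+1)) - T_k * (2y T_(l+1)), where 2y T_(l+1) =
    T_(l+2) + T_l. The bound [k + l + 3] accommodates all four terms. *)
Lemma is_cheb_coef_conv_mulx a k l (c : nat -> nat -> R) :
  (forall m, is_cheb_coef (conv a (cheb k) (cheb m)) (k + m + 1) (c m)) ->
  is_cheb_coef (fun x => 2 * conv a (fun y => y * cheb k y) (cheb (S l)) x) (k + l + 3)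
    (fun j => coef_mul2x (c (S l)) j + 2 * a * c (S l) j - c (S (S l)) j - c l j).
Proof.
intros Hc.
pose proof (is_cheb_coef_mul2x _ _ _ (Hc (S l))) as H2.
apply (is_cheb_coef_le _ _ (k + l + 3)) in H2; [|lia].
assert (H := Hc (S l)); apply (is_cheb_coef_le _ _ (k + l + 3)) in H; [|lia].
assert (Hp := Hc (S (S l))); apply (is_cheb_coef_le _ _ (k + l + 3)) in Hp; [|lia].
assert (Hm := Hc l); apply (is_cheb_coef_le _ _ (k + l + 3)) in Hm; [|lia].
pose proof (is_cheb_coef_lin 1 1 _ _ _ _ _
  (is_cheb_coef_lin 1 (2 * a) _ _ _ _ _ H2 H)
  (is_cheb_coef_lin (-1) (-1) _ _ _ _ _ Hp Hm)) as [A A0].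
split.
- intros x; rewrite conv_mulx by apply cont_cheb.
  rewrite (conv_ext a (cheb k) (cheb k) (fun y => y * cheb (S l) y)
    (fun y => 1 / 2 * cheb (S (S l)) y + 1 / 2 * cheb l y))
    by (reflexivity || apply x_cheb).
  rewrite conv_lin_r by apply cont_cheb.
  etransitivity; [etransitivity; [|apply (A x)]|].
  + field.
  + f_equal; [ring|apply sum_n_m_ext; intros j; Rring].
- intros j Hj; rewrite <- (A0 j Hj); ring.
Qed.

(** * Elimination of the Kronecker factors *)

Lemma mult_delta_leb r j m : ((m < j)%nat -> r = 0) -> r * INR (delta (j <=? m)%nat) = r.
Proof.
intros H; destruct (Nat.leb_spec j m); simpl; [ring|rewrite H by assumption; ring].
Qed.

(* At j = 1 the two halves of c_0 add up, since c_0 enters the expansion halved. *)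
Lemma indexed_mul2x (c : nat -> R) j m : (forall i, (m + 1 < i)%nat -> c i = 0) ->
  c (j - 1)%nat / 2 ^ delta (j =? 1)%nat * INR (delta (0 <? j)%nat)
  + 1 / 2 * c 0%nat * INR (delta (j =? 1)%nat)
  + 2 ^ delta (j =? 0)%nat * c (j + 1)%nat * INR (delta (j <=? m)%nat) = coef_mul2x c j.
Proof.
intros H; rewrite mult_delta_leb by (intros; rewrite H by lia; ring).
(* At [j = 0] the truncated [j - 1] is 0, but the factor for [0 < j] removes that term. *)
destruct j as [|[|j]]; [simpl; field|simpl; field|].
replace (S (S j) + 1)%nat with (S (S (S j))) by lia.
simpl; field.
Qed.

(** * Initial values and recurrences *)

Theorem mainTheorem3 :
  forall (e : sign) (t : nat -> nat -> nat -> R),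
  is_conv_coef e t ->
  (* (a) *)
  (t 1%nat 0%nat 0%nat = - (1 / 2) /\
   t 1%nat 0%nat 2%nat = 1 / 4 /\
   (forall j : nat, j <> 0%nat -> j <> 2%nat -> t 1%nat 0%nat j = 0)) /\
  (* (b) *)
  (forall k : nat, k <> 1%nat ->
   t k 0%nat 0%nat = 2 * sgn e ^ (k + 1) / (INR k ^ 2 - 1) /\
   (k = 0%nat ->
    t k 0%nat 1%nat = 1 /\
    (forall j : nat, j <> 0%nat -> j <> 1%nat -> t k 0%nat j = 0)) /\
   ((1 < k)%nat ->
    t k 0%nat (k - 1)%nat = - (1 / (2 * INR k - 2)) /\
    t k 0%nat (k + 1)%nat = 1 / (2 * INR k + 2) /\
    (forall j : nat, j <> 0%nat -> j <> (k - 1)%nat -> j <> (k + 1)%nat ->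
     t k 0%nat j = 0))) /\
  (* (c) *)
  (forall l j : nat, (0 < l)%nat -> (j <= l + 2)%nat ->
   t 1%nat l j =
   1 / 2 *
   (t 0%nat l (j - 1)%nat / 2 ^ delta (j =? 1)%nat * INR (delta (0 <? j)%nat)
    + 1 / 2 * t 0%nat l 0%nat * INR (delta (j =? 1)%nat)
    + 2 ^ delta (j =? 0)%nat * t 0%nat l (j + 1)%nat * INR (delta (j <=? l)%nat)
    - t 0%nat (l + 1)%nat j
    - t 0%nat (l - 1)%nat j * INR (delta (j <=? l)%nat)
    + 2 * sgn e * t 0%nat l j * INR (delta (j <=? l + 1)%nat))) /\
  (* (d) *)
  (forall k l j : nat, (0 < k)%nat -> (0 < l)%nat -> (j <= k + l + 2)%nat ->
   t (k + 1)%nat l j =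
   t k l (j - 1)%nat / 2 ^ delta (j =? 1)%nat * INR (delta (0 <? j)%nat)
   + 1 / 2 * t k l 0%nat * INR (delta (j =? 1)%nat)
   + 2 ^ delta (j =? 0)%nat * t k l (j + 1)%nat * INR (delta (j <=? k + l)%nat)
   - t k (l + 1)%nat j
   - t k (l - 1)%nat j * INR (delta (j <=? k + l)%nat)
   + 2 * sgn e * t k l j * INR (delta (j <=? k + l + 1)%nat)
   - t (k - 1)%nat l j * INR (delta (j <=? k + l)%nat)).
Proof.
intros e t Ht.
set (a := sgn e).
assert (Hc : forall k l, is_cheb_coef (conv a (cheb k) (cheb l)) (k + l + 1) (t k l)).
{ intros k l; apply (is_cheb_coef_ext (Tconv e k l)); [apply Tconv_conv|apply Ht]. }
assert (Hz : forall k l j, (k + l + 1 < j)%nat -> t k l j = 0) by (intros k l; apply (Hc k l)).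
assert (Haa : a * a = 1) by apply sgn_sqr.
split; [|split; [|split]].
- pose proof (is_cheb_coef_lin (1 / 4) 1 _ _ 2 _ _ (is_cheb_coef_cheb 1 2 (le_n _))
    (is_cheb_coef_const (- (1 / 4)) 2)) as H.
  (* The convolution is (x^2 - a^2) / 2 with a^2 = 1, and x^2 = (T_2 + 1) / 2. *)
  assert (E : forall x, 1 / 4 * cheb 2 x + 1 * - (1 / 4) = conv a (cheb 1) (cheb 0) x).
  { intros x; rewrite (conv_cheb0 a (cheb 1) (fun y => y * y / 2)) by
      (apply cont_cheb || (intros y; auto_derive; [auto|simpl; field])).
    simpl; nra. }
  pose proof (is_cheb_coef_unique _ _ _ _ _ (Hc 1 0)%nat (is_cheb_coef_ext _ _ _ _ E H)) as U.
  rewrite !U; simpl; split; [lra|split; [lra|]].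
  intros j H0 H2; rewrite U.
  destruct (Nat.eqb_spec j 2), (Nat.eqb_spec j 0); try lia; ring.
- intros k Hk; destruct k as [|[|k]]; [|lia|].
  + pose proof (is_cheb_coef_lin 1 1 _ _ 1 _ _ (is_cheb_coef_cheb 0 1 (le_n _))
      (is_cheb_coef_const (- a) 1)) as H.
    assert (E : forall x, 1 * cheb 1 x + 1 * - a = conv a (cheb 0) (cheb 0) x).
    { intros x; rewrite (conv_cheb0 a (cheb 0) (fun y => y)) by
        (apply cont_cheb || (intros y; auto_derive; [auto|reflexivity])).
      simpl; lra. }
    pose proof (is_cheb_coef_unique _ _ _ _ _ (Hc 0 0)%nat (is_cheb_coef_ext _ _ _ _ E H)) as U.
    split; [rewrite U; fold a; simpl; field|split; [intros _|lia]].
    split; [rewrite U; simpl; ring|].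
    intros j H0 H1; rewrite U.
    destruct (Nat.eqb_spec j 1), (Nat.eqb_spec j 0); try lia; ring.
  (* Here [k] is the original index minus 2; [u] and [v] are the coefficients of the antiderivative
     in [is_derive_primitive], and [w] is minus its value at [a]. *)
  + set (u := / (2 * INR (S (S (S k))))); set (v := - / (2 * INR (S k))).
    set (w := - (u * a ^ S (S (S k)) + v * a ^ S k)).
    assert (L1 : (S (S (S k)) <= k + 3)%nat) by lia.
    assert (L2 : (S k <= k + 3)%nat) by lia.
    pose proof (is_cheb_coef_lin 1 1 _ _ (k + 3) _ _
      (is_cheb_coef_lin u v _ _ (k + 3) _ _ (is_cheb_coef_cheb _ _ L1) (is_cheb_coef_cheb _ _ L2))
      (is_cheb_coef_const w (k + 3))) as H.
    assert (E : forall x, 1 * (u * cheb (S (S (S k))) x + v * cheb (S k) x) + 1 * w =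
      conv a (cheb (S (S k))) (cheb 0) x).
    { intros x; rewrite (conv_cheb0 a _ _ x (is_derive_primitive k) (cont_cheb _)).
      fold u v; unfold a at 1 2; rewrite !cheb_sgn; fold a; unfold w; ring. }
    pose proof (is_cheb_coef_unique _ _ _ _ _ (Hc (S (S k)) 0)%nat
      (is_cheb_coef_ext _ _ _ _ E H)) as U.
    pose proof (pos_INR k) as P.
    split; [|split; [lia|intros _; split; [|split]]].
    * rewrite U; cbn [Nat.eqb]; unfold w, u, v; fold a.
      replace (S (S k) + 1)%nat with (S (S (S k))) by lia.
      (* As a^2 = 1, both powers agree and factor out of [w], leaving [u + v]. *)
      replace (a ^ S (S (S k))) with (a ^ S k)
        by (cbn [pow]; rewrite <- !Rmult_assoc, Haa; ring).
      rewrite !S_INR; field; repeat split; nra.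
    * replace (S (S k) - 1)%nat with (S k) by lia; rewrite U.
      destruct (Nat.eqb_spec (S k) (S (S (S k)))); [lia|].
      rewrite Nat.eqb_refl; cbn [Nat.eqb]; unfold v; rewrite !S_INR; field; lra.
    * replace (S (S k) + 1)%nat with (S (S (S k))) by lia; rewrite U.
      destruct (Nat.eqb_spec (S (S (S k))) (S k)); [lia|].
      rewrite Nat.eqb_refl; cbn [Nat.eqb]; unfold u; rewrite !S_INR; field; lra.
    * intros j H0 H1 H2; rewrite U.
      destruct (Nat.eqb_spec j (S (S (S k)))), (Nat.eqb_spec j (S k)),
        (Nat.eqb_spec j 0); try lia; ring.
- intros l j Hl Hj; destruct l as [|l]; [lia|].
  rewrite indexed_mul2x by (intros i Hi; apply Hz; lia).
  replace (S l + 1)%nat with (S (S l)) by lia; replace (S l - 1)%nat with l by lia.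
  (* The cutoffs only remove coefficients beyond the degree bound, which are zero. *)
  rewrite !mult_delta_leb by (intros Hi; rewrite Hz by lia; ring).
  pose proof (is_cheb_coef_conv_mulx a 0 l _ (Hc 0%nat)) as H.
  (* Plain scaling by 1/2, with a dummy second term: T_1 = y T_0 lacks the factor 2 of the general
     recurrence. *)
  pose proof (is_cheb_coef_lin (1 / 2) 0 _ _ _ _ _ H H) as H'.
  assert (E : forall x,
    1 / 2 * (2 * conv a (fun y => y * cheb 0 y) (cheb (S l)) x)
    + 0 * (2 * conv a (fun y => y * cheb 0 y) (cheb (S l)) x) =
    conv a (cheb 1) (cheb (S l)) x).
  { intros x; rewrite (conv_ext a (cheb 1) (fun y => y * cheb 0 y) (cheb (S l)) (cheb (S l)))
      by (reflexivity || (intros y; simpl; ring)).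
    field. }
  rewrite (is_cheb_coef_unique _ _ _ _ _ (Hc 1 (S l))%nat (is_cheb_coef_ext _ _ _ _ E H')).
  fold a; ring.
- intros k l j Hk Hl Hj; destruct k as [|k]; [lia|]; destruct l as [|l]; [lia|].
  rewrite indexed_mul2x by (intros i Hi; apply Hz; lia).
  replace (S l + 1)%nat with (S (S l)) by lia; replace (S l - 1)%nat with l by lia.
  replace (S k + 1)%nat with (S (S k)) by lia; replace (S k - 1)%nat with k by lia.
  rewrite !mult_delta_leb by (intros Hi; rewrite Hz by lia; ring).
  pose proof (is_cheb_coef_conv_mulx a (S k) l _ (Hc (S k))) as H.
  assert (L : (k + S l + 1 <= S k + l + 3)%nat) by lia.
  (* The three-term recurrence T_(k+2) = 2y T_(k+1) - T_k in the left factor. *)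
  pose proof (is_cheb_coef_lin 1 (-1) _ _ _ _ _ H (is_cheb_coef_le _ _ _ _ L (Hc k (S l)))) as H'.
  assert (E : forall x,
    1 * (2 * conv a (fun y => y * cheb (S k) y) (cheb (S l)) x)
    + -1 * conv a (cheb k) (cheb (S l)) x =
    conv a (cheb (S (S k))) (cheb (S l)) x).
  { intros x; rewrite (conv_ext a (cheb (S (S k)))
        (fun y => 2 * (y * cheb (S k) y) + -1 * cheb k y) (cheb (S l)) (cheb (S l)))
      by (reflexivity || (intros y; rewrite cheb_SS; ring)).
    rewrite conv_lin_l by (apply cont_cheb || apply cont_mulx, cont_cheb).
    ring. }
  rewrite (is_cheb_coef_unique _ _ _ _ _ (Hc (S (S k)) (S l)) (is_cheb_coef_ext _ _ _ _ E H')).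
  fold a; ring.
Qed.
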